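(* Let $\mathbb{O}=(W,(\cdot|\cdot),\wedge)$ be the real Cayley–Dickson octonion division algebra, with $W\cong\mathbb{R}^7$ regarded as a Euclidean space for $-(\cdot|\cdot)$, and let $\varphi,\psi$ be two automorphisms of the real vector space $W$. Then: (1) $\mathbb{O}(\varphi)\simeq\mathbb{O}$ if and only if $\varphi\in O_7(\mathbb{R})$. (2) $\mathbb{O}(\varphi)=\mathbb{O}(\psi)$ if and only if $\widetilde{\varphi\psi^{-1}}\in G_2$. (3) $\mathbb{O}(\varphi)\simeq\mathbb{O}(\psi)$ if and only if there exists $f\in O_7(\mathbb{R})$ such that $\widetilde{\varphi f\psi^{-1}}\in G_2$.
   Context: For an anticommutative bilinear product $\ast$ on a real vector space $W$ and a symmetric bilinear form $(\cdot|\cdot)$ on $W$, $(W,(\cdot|\cdot),\ast)$ denotes the real algebra $\mathbb{R}1\oplus W$ with product $(\alpha+x)(\beta+y)=(\alpha\beta+(x|y))+(\alpha y+\beta x+x\ast y)$. The real octonion division algebra $\mathbb{O}$ is of this form with $W$ the 7-dimensional space of purely imaginary octonions, $(x|y)$ the scalar part and $x\wedge y$ the imaginary part of $xy$; here $(\cdot|\cdot)$ is negative definite. For a linear automorphism $\varphi$ of $W$, with adjoint $\varphi^*$ for $(\cdot|\cdot)$, $\mathbb{O}(\varphi)$ denotes the algebra $(W,(\cdot|\cdot),\Delta)$ with $x\Delta y=\varphi^*(\varphi(x)\wedge\varphi(y))$ (the vectorial isotope of $\mathbb{O}$ by $\varphi$). Equality $\mathbb{O}(\varphi)=\mathbb{O}(\psi)$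 means that the two products coincide; $\simeq$ means isomorphic as real algebras. $O_7(\mathbb{R})$ is the group of linear isometries of the Euclidean space $(W,-(\cdot|\cdot))$. For a linear automorphism $f$ of $W$, $\widetilde f$ denotes its natural extension $\alpha+u\mapsto\alpha+f(u)$ to $\mathbb{R}1\oplus W$. $G_2$ is the automorphism group of the algebra $\mathbb{O}$. *)

(* Defs.v *)
From HB Require Import structures.
From mathcomp Require Import all_boot all_order all_algebra.
From mathcomp Require Import boolp classical_sets reals.
From mathcomp Require Import ring.

Set Implicit Arguments.
Unset Strict Implicit.
Unset Printing Implicit Defensive.

Import Order.TTheory GRing.Theory Num.Theory.

Local Open Scope ring_scope.

(* Octonions are not associative, so algebras are handled as a module         *)
(* together with a bare product.                                              *)
Section AlgebraIsomorphisms.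
Variable R : realType.

Definition is_alg_iso (A B : lmodType R) (mulA : A -> A -> A)
    (mulB : B -> B -> B) (f : A -> B) : Prop :=
  [/\ linear f, bijective f & forall x y, f (mulA x y) = mulB (f x) (f y)].

Definition alg_isomorphic (A B : lmodType R) (mulA : A -> A -> A)
    (mulB : B -> B -> B) : Prop :=
  exists f : A -> B, is_alg_iso mulA mulB f.

Definition is_alg_aut (A : lmodType R) (mulA : A -> A -> A) (f : A -> A) : Prop :=
  is_alg_iso mulA mulA f.

End AlgebraIsomorphisms.

Section VectorialAlgebras.
Variables (R : realType) (W : vectType R).
Implicit Types (b : W -> W -> R) (m : W -> W -> W) (f : 'End(W)).

(* The product of the algebra (W, b, m); the pair (a, x) stands for a + x.    *)
Definition valg_mul b m (u v : (R^o * W)%type) : (R^o * W)%type :=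
  (u.1 * v.1 + b u.2 v.2, u.1 *: v.2 + v.1 *: u.2 + m u.2 v.2).

Definition is_adjoint b f (g : 'End(W)) : Prop :=
  forall x y, b (f x) y = b x (g y).

(* Unspecified when f has no adjoint; see [oform_adjointP] below.             *)
Definition adjoint b f : 'End(W) := xget 0 [set g | is_adjoint b f g].

Definition isotope_prod b m f (x y : W) : W := adjoint b f (m (f x) (f y)).

Definition isotope_mul b m f := valg_mul b (isotope_prod b m f).

Definition valg_ext f (u : (R^o * W)%type) : (R^o * W)%type := (u.1, f u.2).

End VectorialAlgebras.

Section CayleyDickson.
Variables (A : zmodType) (mul : A -> A -> A) (conj : A -> A).

Definition cd_mul (x y : A * A) : A * A :=
  (mul x.1 y.1 - mul (conj y.2) x.2, mul y.2 x.1 + mul x.2 (conj y.1)).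

Definition cd_conj (x : A * A) : A * A := (conj x.1, - x.2).

End CayleyDickson.

Section Octonions.
Variable R : realType.

Definition cplx : vectType R := (R^o * R^o)%type.
Definition quat : vectType R := (cplx * cplx)%type.
Definition octonion : vectType R := (quat * quat)%type.

Definition cplx_mul : cplx -> cplx -> cplx := cd_mul (@GRing.mul R) id.
Definition cplx_conj : cplx -> cplx := @cd_conj R^o id.
Definition quat_mul : quat -> quat -> quat := cd_mul cplx_mul cplx_conj.
Definition quat_conj : quat -> quat := cd_conj cplx_conj.
Definition oct_mul : octonion -> octonion -> octonion :=
  cd_mul quat_mul quat_conj.

Definition oct_one : octonion := (((1, 0), 0), 0).
Definition oct_re (x : octonion) : R^o := x.1.1.1.
Definition oct_im (x : octonion) : octonion := x - oct_re x *: oct_one.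

Lemma oct_re_is_linear : linear oct_re.
Proof. by []. Qed.

HB.instance Definition _ :=
  GRing.isLinear.Build R octonion R^o *:%R oct_re oct_re_is_linear.

Definition imO : {vspace octonion} := lker (linfun oct_re).
Definition W : vectType R := subvs_of imO.

(* (x|y) and the wedge product: scalar and imaginary parts of xy.             *)
(* vsproj only retypes here, since oct_im _ lies in imO (see [oct_im_imO]).   *)
Definition oform (x y : W) : R := oct_re (oct_mul (vsval x) (vsval y)).
Definition wedge (x y : W) : W :=
  vsproj imO (oct_im (oct_mul (vsval x) (vsval y))).

Definition OO_mul := valg_mul oform wedge.

Definition isotope (f : 'End(W)) := isotope_mul oform wedge f.

Definition euclid (x y : W) : R := - oform x y.

(* Such an f is bijective, since euclid is positive definite.                 *)
Definition O7 (f : 'End(W)) : Prop :=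
  forall x y, euclid (f x) (f y) = euclid x y.

Definition G2 (g : (R^o * W)%type -> (R^o * W)%type) : Prop :=
  is_alg_aut OO_mul g.

Lemma mem_imO x : (x \in imO) = (oct_re x == 0).
Proof. by rewrite memv_ker lfunE. Qed.

Lemma oct_im_imO x : oct_im x \in imO.
Proof.
by rewrite mem_imO /oct_im /oct_re /= /GRing.scale /= mulr1 subrr.
Qed.

Lemma val_wedge x y :
  vsval (wedge x y) = oct_im (oct_mul (vsval x) (vsval y)).
Proof. by rewrite /wedge vsprojK ?oct_im_imO. Qed.

Let mk (r a b c d e f g : R) : octonion :=
  (((r, a), (b, c)), ((d, e), (f, g))).

Let normq (x : octonion) : R :=
  x.1.1.1 ^+ 2 + x.1.1.2 ^+ 2 + x.1.2.1 ^+ 2 + x.1.2.2 ^+ 2 +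
  x.2.1.1 ^+ 2 + x.2.1.2 ^+ 2 + x.2.2.1 ^+ 2 + x.2.2.2 ^+ 2.

(* Hence octonions have no zero divisors.                                     *)
Lemma oct_norm_mul x y : normq (oct_mul x y) = normq x * normq y.
Proof.
case: x => [[[x0 x1] [x2 x3]] [[x4 x5] [x6 x7]]].
case: y => [[[y0 y1] [y2 y3]] [[y4 y5] [y6 y7]]].
rewrite /normq /oct_mul /quat_mul /cplx_mul /quat_conj /cplx_conj /=.
rewrite /cd_mul /cd_conj /=.
ring.
Qed.

Let scaleRE (a : R) (x : R^o) : a *: x = a * x :> R.
Proof. by []. Qed.

Lemma W_re (x : W) : (vsval x).1.1.1 = 0.
Proof. by apply/eqP; have := subvsP x; rewrite mem_imO. Qed.

Lemma oformE (x y : W) : oform x y =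
  - ((vsval x).1.1.2 * (vsval y).1.1.2 + (vsval x).1.2.1 * (vsval y).1.2.1 +
     (vsval x).1.2.2 * (vsval y).1.2.2 + (vsval x).2.1.1 * (vsval y).2.1.1 +
     (vsval x).2.1.2 * (vsval y).2.1.2 + (vsval x).2.2.1 * (vsval y).2.2.1 +
     (vsval x).2.2.2 * (vsval y).2.2.2).
Proof.
have := W_re x; have := W_re y; rewrite /oform.
case: (vsval x) => [[[x0 x1] [x2 x3]] [[x4 x5] [x6 x7]]].
case: (vsval y) => [[[y0 y1] [y2 y3]] [[y4 y5] [y6 y7]]] /= -> ->.
rewrite /oct_re /oct_mul /quat_mul /cplx_mul /quat_conj /cplx_conj /=.
rewrite /cd_mul /cd_conj /=.
ring.
Qed.

(* So (W, (.|.), wedge) is the Cayley-Dickson algebra of octonions itself.    *)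
Lemma OO_octonion : is_alg_iso OO_mul oct_mul
  (fun u : (R^o * W)%type => u.1 *: oct_one + vsval u.2).
Proof.
split.
- have aux (a u v : R) (X Y : octonion) :
      (a * u + v) *: oct_one + (a *: X + Y) =
      a *: (u *: oct_one + X) + (v *: oct_one + Y).
    by rewrite scalerDl scalerDr scalerA addrACA.
  move=> a [u x] [v y]; apply: etrans (aux a u v (vsval x) (vsval y)).
  by congr (_ + _); exact: linearP.
- exists (fun x => (oct_re x, vsproj imO (oct_im x))) => [[a w] | x] /=; last first.
    by rewrite vsprojK ?oct_im_imO // addrC subrK.
  have re_aw : oct_re (a *: oct_one + vsval w) = a.
    by rewrite /oct_re /= W_re addr0 /GRing.scale /= mulr1.
  by rewrite re_aw /oct_im re_aw addrC addKr vsvalK.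
move=> [a x] [b y] /=; rewrite val_wedge /oform /oct_im.
have := W_re x; have := W_re y.
case: (vsval x) => [[[x0 x1] [x2 x3]] [[x4 x5] [x6 x7]]].
case: (vsval y) => [[[y0 y1] [y2 y3]] [[y4 y5] [y6 y7]]] /= -> ->.
rewrite /oct_re /oct_mul /quat_mul /cplx_mul /quat_conj /cplx_conj /=.
rewrite /cd_mul /cd_conj /=.
congr (((_, _), (_, _)), ((_, _), (_, _))); rewrite /= ?scaleRE /=; ring.
Qed.

Lemma oform_adjointP (f : 'End(W)) : is_adjoint oform f (adjoint oform f).
Proof.
rewrite /adjoint; apply: (xgetPex 0).
pose d (i j : nat) : R := (i == j)%:R.
pose e i : W :=
  vsproj imO (mk 0 (d i 0) (d i 1) (d i 2) (d i 3) (d i 4) (d i 5) (d i 6))%N.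
have val_e i : vsval (e i) =
    (mk 0 (d i 0) (d i 1) (d i 2) (d i 3) (d i 4) (d i 5) (d i 6))%N.
  by rewrite vsprojK // mem_imO.
have oformDr x y z : oform x (y + z) = oform x y + oform x z.
  by rewrite !oformE /=; ring.
have oformZr a x y : oform x (a *: y) = a * oform x y.
  by rewrite !oformE /= /GRing.scale /=; ring.
have oformC x y : oform x y = oform y x by rewrite !oformE; ring.
have oform0 x : oform x 0 = 0 by rewrite -(scale0r 0) oformZr mul0r.
have oform_sumr x (F : 'I_7 -> W) :
    oform x (\sum_i F i) = \sum_i oform x (F i).
  exact: (big_morph (oform x) (oformDr x) (oform0 x)).
have W_sum x : x = \sum_(i < 7) (- oform x (e i)) *: e i.
  apply/subvs_inj.
  have -> : vsval (\sum_(i < 7) (- oform x (e i)) *: e i) =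
      \sum_(i < 7) (- oform x (e i)) *: vsval (e i).
    by rewrite linear_sum; apply: eq_bigr => i _; exact: linearZ.
  rewrite !big_ord_recl big_ord0 !oformE !val_e /mk /d /=.
  have := W_re x.
  case: (vsval x) => [[[x0 x1] [x2 x3]] [[x4 x5] [x6 x7]]] /= ->.
  congr (((_, _), (_, _)), ((_, _), (_, _))); rewrite /= ?scaleRE /=; ring.
pose g0 y : W := \sum_(i < 7) (- oform (f (e i)) y) *: e i.
have g0_lin : linear g0.
  move=> a y z; rewrite /g0 scaler_sumr -big_split /=; apply: eq_bigr => i _.
  by rewrite oformDr oformZr opprD scalerDl scalerA mulrN.
pose gL := GRing.isLinear.Build R W W *:%R g0 g0_lin.
pose g : {linear W -> W} := HB.pack g0 gL.
exists (linfun g) => x y; rewrite lfunE /= /g0 oform_sumr.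
rewrite {1}(W_sum x) linear_sum oformC oform_sumr /=; apply: eq_bigr => i _.
by rewrite linearZ /= !oformZr (oformC y) !mulNr mulrC.
Qed.

End Octonions.

(* Main.v *)
Require Import Defs.
From HB Require Import structures.
From mathcomp Require Import all_boot all_order all_algebra.
From mathcomp Require Import reals.
From mathcomp Require Import ring lra.

(* Writing T(x, y, z) = (x ^ y | z), the isotope product of [f] is dual to the
   trilinear form T(f x, f y, f z), so equality of isotopes of [f] and [g] says
   that [f g^-1] preserves T. The heart of the matter is that a linear bijection
   preserving T is an isometry (hence an automorphism). Over the complexification,
   the cross product with a vector [p] has a kernel larger than the line of [p]
   exactly when (p|p) = 0, by p ^ (p ^ q) = (p|p) q - (p|q) p, and this condition
   on [p] depends only on T. Taking p = a + i b, a map preserving T sends orthogonal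
   pairs of equal norm to orthogonal pairs of equal norm, so it is conformal, and
   comparing the norms of both sides of c g(x) ^ g(y) = g(x ^ y) forces c^3 = 1.
   An isomorphism of isotopes fixes 1 and preserves the imaginary parts, so it is
   the extension of an isometry [h], and then O(f) = O(g h). *)

Import Order.TTheory GRing.Theory Num.Theory.

Set Implicit Arguments.
Unset Strict Implicit.
Unset Printing Implicit Defensive.

Local Open Scope ring_scope.

(** * Cross products for a negative definite form *)

(** Besides the dimension, the argument uses only these properties of octonions. There [cp_sq] is
    the vector part of the alternative law x(xy) = (xx)y. *)
Record cross_product {R : realType} {V : vectType R} (o : V -> V -> R)
    (w : V -> V -> V) : Prop := CrossProduct {
  cpC : forall x y, o x y = o y x;
  cpDr : forall x y z, o x (y + z) = o x y + o x z;
  cpZr : forall k x y, o x (k *: y) = k * o x y;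
  cp_le0 : forall x, o x x <= 0;
  cp_eq0 : forall x, (o x x == 0) = (x == 0);
  cp_anti : forall x y, w x y = - w y x;
  cp_triple : forall x y z, o (w x y) z = o x (w y z);
  cp_sq : forall x y, w x (w x y) = o x x *: y - o x y *: x;
  cp_adjoint : forall f, is_adjoint o f (adjoint o f) }.

Section CrossProduct.
Context {R : realType} {V : vectType R} {o : V -> V -> R} {w : V -> V -> V}.
Context (cp : cross_product o w) (dimV : (3 < dim V)%N).
Implicit Types (x y z a b u v : V) (f g : 'End(V)).

Local Notation "x ^^ y" := (w x y) (at level 40, left associativity).

Let formC := cpC cp.
Let formDr := cpDr cp.
Let formZr := cpZr cp.
Let form_le0 := cp_le0 cp.
Let form_eq0 := cp_eq0 cp.
Let cross_anti := cp_anti cp.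
Let form_cross := cp_triple cp.
Let cross_cross := cp_sq cp.

Lemma formDl x y z : o (x + y) z = o x z + o y z.
Proof. by rewrite formC formDr !(formC z). Qed.

Lemma formZl k x y : o (k *: x) y = k * o x y.
Proof. by rewrite formC formZr formC. Qed.

Lemma formNr x y : o x (- y) = - o x y.
Proof. by rewrite -scaleN1r formZr mulN1r. Qed.

Lemma formNl x y : o (- x) y = - o x y.
Proof. by rewrite formC formNr formC. Qed.

Lemma form0r x : o x 0 = 0.
Proof. by rewrite -(scale0r 0) formZr mul0r. Qed.

Lemma form0l x : o 0 x = 0.
Proof. by rewrite formC form0r. Qed.

Definition form_simp :=
  (formDr, formDl, formNr, formNl, formZr, formZl, form0r, form0l).

Lemma form_inj x y : (forall z, o x z = o y z) -> x = y.
Proof.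
move=> h; apply/eqP; rewrite -subr_eq0 -form_eq0 formDl formNl h.
by rewrite subrr.
Qed.

(** Linearity is not an axiom: after pairing with [q], anticommutativity and [cp_triple] bring the
    sum into a slot of the form. *)
Lemma crossDr x y z : x ^^ (y + z) = x ^^ y + x ^^ z.
Proof.
apply: form_inj => q.
by rewrite cross_anti form_simp form_cross form_simp -!form_cross
  (cross_anti x y) (cross_anti x z) !form_simp opprD.
Qed.

Lemma crossZr k x y : x ^^ (k *: y) = k *: (x ^^ y).
Proof.
apply: form_inj => q.
by rewrite cross_anti form_simp form_cross form_simp -!form_cross
  (cross_anti x y) !form_simp mulrN.
Qed.

Lemma crossNr x y : x ^^ (- y) = - (x ^^ y).
Proof. by rewrite -scaleN1r crossZr scaleN1r. Qed.

Lemma crossDl x y z : (x + y) ^^ z = x ^^ z + y ^^ z.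
Proof. by rewrite cross_anti crossDr opprD -(cross_anti x) -(cross_anti y). Qed.

Lemma cross0r x : x ^^ 0 = 0.
Proof. by have := crossZr 0 x 0; rewrite !scale0r. Qed.

Lemma crossxx x : x ^^ x = 0.
Proof.
apply/eqP; have /eqP := cross_anti x x.
by rewrite -addr_eq0 -mulr2n -scaler_nat scaler_eq0 pnatr_eq0.
Qed.

Lemma form_crossl x y : o x (x ^^ y) = 0.
Proof. by rewrite -form_cross crossxx form0l. Qed.

Lemma cross_cross_polar x y z :
  x ^^ (y ^^ z) + y ^^ (x ^^ z) =
    (2 * o x y) *: z - o x z *: y - o y z *: x.
Proof.
have := cross_cross (x + y) z; rewrite !crossDl !crossDr !cross_cross => h.
apply: form_inj => q; move/(congr1 (o^~ q)): h.
rewrite !form_simp (formC y x); lra.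
Qed.

(** Lagrange's identity, up to the sign of the form. *)
Lemma form_cross_cross x y :
  o (x ^^ y) (x ^^ y) = o x y ^+ 2 - o x x * o y y.
Proof.
rewrite form_cross (cross_anti x y) crossNr cross_cross !form_simp.
by rewrite (formC y x); ring.
Qed.

(** Three linear equations in dimension above 3. The bound matters: in dimension 3, preserving the
    triple product only means having determinant 1. *)
Lemma ex_orthogonal3 a b c :
  exists2 u, u != 0 & [/\ o a u = 0, o b u = 0 & o c u = 0].
Proof.
pose F u : (R^o * R^o * R^o)%type := (o a u, o b u, o c u).
have F_lin : linear F.
  by move=> k u v; congr (_, _, _); rewrite /= !form_simp.
pose FL := GRing.isLinear.Build R V (R^o * R^o * R^o)%type *:%R F F_lin.
pose G : {linear V -> (R^o * R^o * R^o)%type} := HB.pack F FL.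
have := limg_ker_dim (linfun G) fullv.
rewrite capfv dimvf.
have h1 := dimvS (subvf (limg (linfun G))).
rewrite dimvf in h1.
have {h1} : (\dim (limg (linfun G)) <= 3)%N by exact: h1.
move=> h1 h2; have : (0 < \dim (lker (linfun G)))%N.
  move: dimV; rewrite -h2; case: (\dim (lker _)) => // h3.
  by have := leq_trans h3 h1.
rewrite lt0n dimv_eq0 => hk; exists (vpick (lker (linfun G))).
  by rewrite vpick0.
by have := memv_pick (lker (linfun G)); rewrite memv_ker lfunE => /eqP [].
Qed.

(* With [x = a + i b] and [y = u + i v] in the complexification, the first two
   hypotheses say [x ^^ y = 0], and the conclusion is the [x]-[y] coordinate
   form of [0 = x ^^ (x ^^ y) = (x|x) y - (x|y) x]. *)
Lemma complex_cross0 a b u v : a ^^ u = b ^^ v -> a ^^ v = - (b ^^ u) ->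
  exists s t, ((o a a - o b b) ^+ 2 + (2 * o a b) ^+ 2) *: u = s *: a + t *: b.
Proof.
move=> h1 h2.
(* In complex terms c + i d = (x|x), and below s + i t = (x|y). *)
set c := o a a - o b b; set d := 2 * o a b.
pose s := o a u - o b v; pose t := o a v + o b u.
(* [re] and [im] will say (c + i d) y = (s + i t) x. The real part of its product with c - i d has
   these coefficients. *)
exists (c * s + d * t), (d * s - c * t); apply: form_inj => z.
have re : c *: u - d *: v = s *: a - t *: b.
  have hp := cross_cross_polar a b v.
  rewrite -h1 h2 crossNr !cross_cross in hp.
  apply: form_inj => q; move/(congr1 (o^~ q)): hp.
  rewrite !form_simp /c /d /s /t; lra.
have im : c *: v + d *: u = s *: b + t *: a.
  have hp := cross_cross_polar a b u.
  have h2' : b ^^ u = - (a ^^ v) by rewrite h2 opprK.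
  rewrite h1 h2' crossNr !cross_cross in hp.
  apply: form_inj => q; move/(congr1 (o^~ q)): hp.
  rewrite !form_simp /c /d /s /t; lra.
move/(congr1 (o^~ z)): re; move/(congr1 (o^~ z)): im; rewrite !form_simp => im re.
have -> : (c ^+ 2 + d ^+ 2) * o u z =
    c * (c * o u z - d * o v z) + d * (c * o v z + d * o u z) by ring.
move: re im; rewrite -!mulNr => -> ->; ring.
Qed.

(** * Linear bijections preserving the triple product *)

Definition preserves_triple g :=
  forall x y z, o (g x ^^ g y) (g z) = o (x ^^ y) z.

(** The relation can be tested by T against all third arguments, and every vector is some g z. *)
Lemma preserves_triple_cross_eq g : bijective g -> preserves_triple g ->
  forall a b x y, a ^^ x = b ^^ y -> g a ^^ g x = g b ^^ g y.
Proof.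
move=> [g' gK g'K] gT a b x y h; apply: form_inj => z.
by rewrite -(g'K z) !gT h.
Qed.

(** The hypotheses say that x = a + i b is null. Then the cross product with x kills a vector whose
    real part is a nonzero multiple of some u orthogonal to a and b. This relation passes to the
    images, so if g x were not null, [complex_cross0] would put u in the span of a and b. *)
Lemma preserves_triple_null g : bijective g -> preserves_triple g ->
  forall a b, o a b = 0 -> o a a = o b b ->
  o (g a) (g b) = 0 /\ o (g a) (g a) = o (g b) (g b).
Proof.
move=> gB gT a b ab aabb; have [b0|b0] := eqVneq b 0.
  have /eqP : o a a = 0 by rewrite aabb b0 form0l.
  by rewrite form_eq0 => /eqP ->; rewrite b0 linear0 form0l.
have [u u0 [au bu abu]] := ex_orthogonal3 a b (a ^^ b).
have buu : o b (a ^^ u) = 0.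
  by rewrite -form_cross cross_anti formNl abu oppr0.
set s := o b b in aabb.
have s0 : s != 0 by rewrite form_eq0.
(* With x = a + i b, the vector s u + i v is x ^ (a ^ u). Its product with x vanishes since x is
   null and a ^ u is orthogonal to a and b. *)
set v := b ^^ (a ^^ u).
have h1 : a ^^ (s *: u) = b ^^ v.
  by rewrite crossZr /v cross_cross buu scale0r subr0.
have h2 : a ^^ v = - (b ^^ (s *: u)).
  have := cross_cross_polar a b (a ^^ u).
  rewrite ab form_crossl buu mulr0 !scale0r !subr0 cross_cross au.
  by rewrite scale0r subr0 aabb => /eqP; rewrite addr_eq0 => /eqP.
have {}h1 := preserves_triple_cross_eq gB gT h1.
have h2' : a ^^ v = b ^^ (- (s *: u)) by rewrite crossNr.
have {h2 h2'} := preserves_triple_cross_eq gB gT h2'.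
rewrite linearN crossNr => h2.
have [p [q]] := complex_cross0 h1 h2.
(* [e] is the squared modulus of (g x|g x), so it remains to show that it vanishes. *)
set e := _ + _; rewrite -!linearZ -linearD /= => /(bij_inj gB) h.
have : o (s *: (e *: u)) u = 0.
  by rewrite h !form_simp au bu !mulr0 addr0.
move/eqP; rewrite !form_simp !mulf_eq0 (negPf s0) form_eq0 (negPf u0) orbF /=.
rewrite /e paddr_eq0 ?sqr_ge0 // !sqrf_eq0 mulf_eq0 pnatr_eq0 /= subr_eq0.
by case/andP => /eqP-> /eqP->.
Qed.

(** Every vector is compared with a fixed [e]: its component orthogonal to [e] has the norm of some
    multiple of [e], so the null pair lemma applies. Polarization does the rest. *)
Lemma preserves_triple_conformal g : bijective g -> preserves_triple g ->
  exists2 c, 0 < c & forall x y, o (g x) (g y) = c * o x y.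
Proof.
move=> gB gT; have [e e0 _] := ex_orthogonal3 0 0 0.
have e_neq0 : o e e != 0 by rewrite form_eq0.
have e_lt0 : o e e < 0 by rewrite lt_neqAle e_neq0 form_le0.
pose c := o (g e) (g e) / o e e.
have gee : o (g e) (g e) = c * o e e by rewrite divfK.
have c_gt0 : 0 < c.
  rewrite -(ltr_nM2r e_lt0) mul0r -gee lt_neqAle form_le0 andbT form_eq0.
  by apply: contra e0 => /eqP ge0; apply/eqP/(bij_inj gB); rewrite ge0 linear0.
have diag y : o (g y) (g y) = c * o y y.
  have [k [b [-> eb]]] : exists k b, y = b + k *: e /\ o e b = 0.
    exists (o e y / o e e), (y - (o e y / o e e) *: e).
    by rewrite subrK !form_simp divfK // subrr.
  (* The quotient is nonnegative because both norms are nonpositive; [r *: e] has the norm of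
     [b]. *)
  pose r := Num.sqrt (o b b / o e e).
  have r2 : r ^+ 2 = o b b / o e e.
    by rewrite sqr_sqrtr // mulr_le0 ?invr_le0 ?form_le0.
  have [] := preserves_triple_null gB gT (a := r *: e) (b := b).
  - by rewrite form_simp eb mulr0.
  - by rewrite !form_simp mulrA -expr2 r2 divfK.
  rewrite linearZ !form_simp => orth norm.
  have nb : o (g b) (g b) = c * o b b.
    rewrite -norm gee; have -> : o b b = r ^+ 2 * o e e by rewrite r2 divfK.
    by ring.
  have geb : o (g e) (g b) = 0.
    have [r0|r0] := eqVneq r 0; last first.
      by move/eqP: orth; rewrite mulf_eq0 (negPf r0) => /eqP.
    move/eqP: r2; rewrite r0 expr0n eq_sym mulf_eq0 invr_eq0 (negPf e_neq0) orbF.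
    by rewrite form_eq0 => /eqP ->; rewrite linear0 form0r.
  rewrite linearD linearZ !form_simp nb gee (formC (g b)) geb (formC b) eb.
  by ring.
exists c => // x y; have := diag (x + y).
rewrite linearD !form_simp !diag (formC y) (formC (g y)); lra.
Qed.

Lemma preserves_triple_aut g : bijective g -> preserves_triple g ->
  (forall x y, o (g x) (g y) = o x y) /\ (forall x y, g (x ^^ y) = g x ^^ g y).
Proof.
move=> gB gT; have [c c_gt0 gc] := preserves_triple_conformal gB gT.
have ccross x y : c *: (g x ^^ g y) = g (x ^^ y).
  case: gB => g' gK g'K; apply: form_inj => z.
  by rewrite -(g'K z) form_simp gT gc.
have [x x0 _] := ex_orthogonal3 0 0 0.
have [y y0 [xy _ _]] := ex_orthogonal3 x 0 0.
have n0 : o (x ^^ y) (x ^^ y) != 0.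
  by rewrite form_cross_cross xy expr0n sub0r oppr_eq0 mulf_neq0 ?form_eq0.
have c3 : c ^+ 3 = 1.
  (* The norm of [g (x ^^ y)] in two ways: by conformality, and as c^2 times that of [g x ^^ g y],
     where Lagrange's identity yields another c^2. *)
  have h : c * o (x ^^ y) (x ^^ y) = c ^+ 4 * o (x ^^ y) (x ^^ y).
    rewrite -gc -ccross !form_simp !form_cross_cross !gc; ring.
  apply: (mulfI (lt0r_neq0 c_gt0)); rewrite -exprS mulr1.
  by apply: (mulIf n0); rewrite -h.
have c1 : c = 1 by apply/eqP; rewrite -(@pexpr_eq1 _ c 3) ?c3 ?ltW.
by split=> u v; [rewrite gc c1 mul1r | rewrite -ccross c1 scale1r].
Qed.

(** * Isometries and isomorphisms of vector algebras *)

Lemma isometry_inj f : (forall x y, o (f x) (f y) = o x y) -> injective f.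
Proof.
move=> fo x y /eqP; rewrite -subr_eq0 -linearB -form_eq0 fo form_eq0 subr_eq0.
by move/eqP.
Qed.

Lemma lfun_inj_bij f : injective f -> bijective f.
Proof.
move=> /lker0P f0; exists (f^-1)%VF => x; last exact: lker0_lfunVK.
exact: lker0_lfunK.
Qed.

Lemma lfun_bijK f : bijective f -> cancel f (f^-1)%VF.
Proof. by move=> /bij_inj /lker0P f0 x; exact: lker0_lfunK. Qed.

Lemma lfun_bijVK f : bijective f -> cancel (f^-1)%VF f.
Proof. by move=> /bij_inj /lker0P f0 x; exact: lker0_lfunVK. Qed.

Lemma valg_ext_iso (m1 m2 : V -> V -> V) f : bijective f ->
  (forall x y, o (f x) (f y) = o x y) ->
  (forall x y, f (m1 x y) = m2 (f x) (f y)) ->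
  is_alg_iso (valg_mul o m1) (valg_mul o m2) (valg_ext f).
Proof.
move=> [f' fK f'K] fo fm; split.
- by move=> k [a x] [b y]; rewrite /valg_ext /= linearP.
- by exists (fun p => (p.1, f' p.2)) => -[a x]; rewrite /valg_ext /= ?fK ?f'K.
- by move=> [a x] [b y]; rewrite /valg_ext /valg_mul /= fo -fm !linearD !linearZ.
Qed.

(** This turns membership in G2 into invariance of T; the converse direction is where T has to
    determine both the form and the product. *)
Lemma valg_ext_autP g : bijective g ->
  is_alg_aut (valg_mul o w) (valg_ext g) <-> preserves_triple g.
Proof.
move=> gB; split=> [[_ _ gM] | /(preserves_triple_aut gB)[go gw]]; last first.
  exact: valg_ext_iso.
have {}gM x y := gM (0, x) (0, y).
move=> x y z; case: (gM x y) (gM (x ^^ y) z).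
rewrite /valg_mul /= !mul0r !add0r !scale0r !add0r => _ gxy [gxyz _].
by rewrite -gxy gxyz.
Qed.

(* The unit goes to the unit, and the vectors are singled out by having their
   square in [R1] while not lying in [R1] themselves. *)
Lemma valg_iso_vector (m1 m2 : V -> V -> V) F :
  (forall x, m1 x x = 0) -> (forall x, m2 x x = 0) ->
  (forall x, m1 0 x = 0) -> (forall x, m2 x 0 = 0) ->
  is_alg_iso (valg_mul o m1) (valg_mul o m2) F ->
  exists2 f : 'End(V), (forall x y, o (f x) (f y) = o x y)
    & forall x y, f (m1 x y) = m2 (f x) (f y).
Proof.
move=> m1xx m2xx m10 m20 [Flin [F' FK F'K] FM].
have F1 : F (1, 0) = (1, 0).
  (* 1 = F(F' 1) = F(1 F' 1) = F(1) 1 = F(1). *)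
  have := FM (1, 0) (F' (1, 0)); rewrite F'K.
  have -> : valg_mul o m1 (1, 0) (F' (1, 0)) = F' (1, 0).
    case: (F' _) => a x; rewrite /valg_mul /=.
    by rewrite form0l addr0 mul1r scale1r scaler0 m10 !addr0.
  rewrite F'K; case: (F (1, 0)) => a x; rewrite /valg_mul /=.
  by rewrite form0r addr0 mulr1 scale1r scaler0 m20 add0r addr0 => ->.
have F0 : F (0, 0) = (0, 0).
  have := Flin (-1) (1, 0) (1, 0); rewrite F1.
  have -> k : k *: (1, 0) + (1, 0) = (k + 1, 0) :> (R^o * V)%type.
    by congr (_, _); rewrite /= ?scaler0 ?addr0 // /GRing.scale /= mulr1.
  by rewrite addNr.
have Fsc k : F (k, 0) = (k, 0).
  have := Flin k (1, 0) (0, 0); rewrite F1 F0.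
  have -> : k *: (1, 0) + (0, 0) = (k, 0) :> (R^o * V)%type.
    by congr (_, _); rewrite /= ?scaler0 ?addr0 // /GRing.scale /= mulr1.
  by [].
have Fim x : (F (0, x)).1 = 0.
  have := FM (0, x) (0, x).
  rewrite {1}/valg_mul /= mul0r add0r !scale0r m1xx !addr0 Fsc.
  (* The square of a + y has vector part 2 a y, so a = 0 or y = 0. In the latter case F sends both x
     and a to a, and injectivity gives a = 0. *)
  case E: (F (0, x)) => [a y]; rewrite /valg_mul /= m2xx addr0 => -[_ /eqP].
  rewrite -scalerDl eq_sym scaler_eq0 -mulr2n mulrn_eq0 /=.
  move=> /orP[/eqP // | /eqP y0].
  by move: E; rewrite y0 -(Fsc a) => /(can_inj FK) [].
pose h x := (F (0, x)).2.
have Fh x : F (0, x) = (0, h x).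
  by rewrite /h; case: (F (0, x)) (Fim x) => k y /= ->.
have hlin : linear h.
  move=> k x y; have := Flin k (0, x) (0, y).
  have -> : k *: (0, x) + (0, y) = (0, k *: x + y) :> (R^o * V)%type.
    by congr (_, _); rewrite /= scaler0 addr0.
  by rewrite !Fh => -[_ ->].
pose hL := GRing.isLinear.Build R V V *:%R h hlin.
pose g : {linear V -> V} := HB.pack h hL.
have hM x y : (o x y, h (m1 x y)) = (o (h x) (h y), m2 (h x) (h y)).
  have := FM (0, x) (0, y); rewrite !Fh /valg_mul /=.
  rewrite !mul0r !scale0r !add0r => <-.
  have := Flin 1 (o x y, 0) (0, m1 x y); rewrite !scale1r Fsc Fh.
  have e (a : R) z : (a, 0) + (0, z) = (a, z) :> (R^o * V)%type.
    by congr (_, _); rewrite /= ?addr0 ?add0r.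
  by rewrite !e => ->.
exists (linfun g) => x y; rewrite !lfunE /=; first by case: (hM x y).
by case: (hM x y).
Qed.

(** * Equality and isomorphism of isotopes *)

Lemma form_isotope f x y z :
  o (isotope_prod o w f x y) z = o (f x ^^ f y) (f z).
Proof. by rewrite formC /isotope_prod -(cp_adjoint cp) formC. Qed.

Lemma isotope_mul_eqP f g : bijective g ->
  (forall p q, isotope_mul o w f p q = isotope_mul o w g p q) <->
  preserves_triple (f \o g^-1)%VF.
Proof.
move=> gB; split=> [h x y z | h [a x] [b y]].
  rewrite !comp_lfunE -form_isotope.
  have /(congr1 snd) := h (0, (g^-1)%VF x) (0, (g^-1)%VF y).
  rewrite /= !scale0r !add0r => ->.
  by rewrite form_isotope !(lfun_bijVK gB).
rewrite /isotope_mul /valg_mul /=; congr (_, _ + _); apply: form_inj => z.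
by rewrite !form_isotope -(h (g x)) !comp_lfunE !(lfun_bijK gB).
Qed.

Lemma isotope_isoP f g :
  alg_isomorphic (isotope_mul o w f) (isotope_mul o w g) <->
  exists2 h : 'End(V), (forall x y, o (h x) (h y) = o x y)
    & forall x y z,
      o (f x ^^ f y) (f z) = o (g (h x) ^^ g (h y)) (g (h z)).
Proof.
split=> [[F /valg_iso_vector[|||| h ho hM]] | [h ho hT]].
- by move=> x; rewrite /isotope_prod crossxx linear0.
- by move=> x; rewrite /isotope_prod crossxx linear0.
- by move=> x; rewrite /isotope_prod linear0 cross_anti cross0r oppr0 linear0.
- by move=> x; rewrite /isotope_prod linear0 cross0r linear0.
- by exists h => // x y z; rewrite -!form_isotope -hM ho.
have hB := lfun_inj_bij (isometry_inj ho).
exists (valg_ext h); apply: valg_ext_iso => // x y; apply: form_inj => z.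
by rewrite -(lfun_bijVK hB z) ho !form_isotope hT.
Qed.

Lemma isotope_iso_ext_autP f g : bijective f -> bijective g ->
  alg_isomorphic (isotope_mul o w f) (isotope_mul o w g) <->
  exists h : 'End(V), (forall x y, o (h x) (h y) = o x y) /\
    is_alg_aut (valg_mul o w) (valg_ext ((f \o h) \o g^-1)%VF).
Proof.
move=> fB gB; rewrite isotope_isoP.
have compB (h : 'End(V)) : (forall x y, o (h x) (h y) = o x y) ->
    bijective ((f \o h) \o g^-1)%VF.
  move=> ho; apply: lfun_inj_bij => x y; rewrite !comp_lfunE.
  move=> /(bij_inj fB) /(isometry_inj ho).
  exact: (can_inj (lfun_bijVK gB)).
split=> [[h ho hT] | [h [ho /(valg_ext_autP (compB _ ho)) hT]]].
  have hB := lfun_inj_bij (isometry_inj ho).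
  have h'o x y : o ((h^-1)%VF x) ((h^-1)%VF y) = o x y.
    by rewrite -ho !(lfun_bijVK hB).
  (* T(f, f, f) = T(g h, g h, g h) means that f h^-1 g^-1 preserves T, so the isometry between f and
     g^-1 is the inverse of h. *)
  exists (h^-1)%VF; split => //; apply/(valg_ext_autP (compB _ h'o)) => x y z.
  by rewrite !comp_lfunE hT !(lfun_bijVK hB) !(lfun_bijVK gB).
have hB := lfun_inj_bij (isometry_inj ho).
exists (h^-1)%VF => x y; first by rewrite -ho !(lfun_bijVK hB).
move=> z; rewrite -(hT _ _ (g ((h^-1)%VF z))).
by rewrite !comp_lfunE !(lfun_bijK gB) !(lfun_bijVK hB).
Qed.

(** The algebra is its own isotope by the identity, so an isomorphism yields an isometry h with f
    h^-1 preserving T, hence isometric, and so is f. Conversely the extension of an isometric f is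
    itself an isomorphism, the adjoint of f being its inverse. *)
Lemma isotope_iso_isometryP f : bijective f ->
  alg_isomorphic (isotope_mul o w f) (valg_mul o w) <->
  forall x y, o (f x) (f y) = o x y.
Proof.
move=> fB; split; last first.
  move=> fo; exists (valg_ext f); apply: valg_ext_iso => // x y.
  by apply: form_inj => z; rewrite -(lfun_bijVK fB z) fo form_isotope.
have isotope1 : isotope_mul o w \1%VF = valg_mul o w.
  rewrite /isotope_mul; congr valg_mul.
  apply/boolp.funext => x; apply/boolp.funext => y; apply: form_inj => z.
  by rewrite form_isotope !id_lfunE.
rewrite -isotope1 isotope_isoP => -[h ho hT].
have hB := lfun_inj_bij (isometry_inj ho).
have kB : bijective (f \o h^-1)%VF.
  apply: lfun_inj_bij => x y; rewrite !comp_lfunE => /(bij_inj fB).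
  exact: (can_inj (lfun_bijVK hB)).
have [|ko _ x y] := preserves_triple_aut kB.
  by move=> x y z; rewrite !comp_lfunE hT !(lfun_bijVK hB) !id_lfunE.
by rewrite -(ho x) -(ko (h x)) !comp_lfunE !(lfun_bijK hB).
Qed.

End CrossProduct.

(** * The wedge of imaginary octonions is a cross product *)

Section OctonionCrossProduct.
Context {R : realType}.
Implicit Types (x y z : W R).

Local Notation o := (@oform R).
Local Notation "x ^^ y" := (@wedge R x y) (at level 40, left associativity).

Lemma vsvalD x y : vsval (x + y) = vsval x + vsval y.
Proof. exact: linearD. Qed.

Lemma vsvalZ k x : vsval (k *: x) = k *: vsval x.
Proof. exact: linearZ. Qed.

Lemma vsvalN x : vsval (- x) = - vsval x.
Proof. exact: linearN. Qed.

Lemma oformC x y : o x y = o y x.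
Proof. by rewrite !oformE; ring. Qed.

Lemma oformDr x y z : o x (y + z) = o x y + o x z.
Proof.
rewrite !oformE vsvalD.
case: (vsval x) => [[[x0 x1] [x2 x3]] [[x4 x5] [x6 x7]]].
case: (vsval y) => [[[y0 y1] [y2 y3]] [[y4 y5] [y6 y7]]].
case: (vsval z) => [[[z0 z1] [z2 z3]] [[z4 z5] [z6 z7]]] /=.
ring.
Qed.

Lemma oformZr k x y : o x (k *: y) = k * o x y.
Proof.
rewrite !oformE vsvalZ.
case: (vsval x) => [[[x0 x1] [x2 x3]] [[x4 x5] [x6 x7]]].
case: (vsval y) => [[[y0 y1] [y2 y3]] [[y4 y5] [y6 y7]]] /=.
rewrite /GRing.scale /=; ring.
Qed.

Lemma oform_le0 x : o x x <= 0.
Proof. by rewrite oformE oppr_le0 -!expr2 !addr_ge0 ?sqr_ge0. Qed.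

Lemma oform_eq0 x : (o x x == 0) = (x == 0).
Proof.
apply/idP/eqP => [|->]; last by rewrite -(scale0r 0) oformZr mul0r.
rewrite oformE oppr_eq0 -!expr2.
rewrite !paddr_eq0 ?addr_ge0 ?sqr_ge0 // !sqrf_eq0.
case/andP => /andP[/andP[/andP[/andP[/andP[/eqP h1 /eqP h2]
  /eqP h3] /eqP h4] /eqP h5] /eqP h6] /eqP h7.
apply/subvs_inj; rewrite linear0; move: (W_re x) h1 h2 h3 h4 h5 h6 h7.
by case: (vsval x) => [[[? ?] [? ?]] [[? ?] [? ?]]] /= -> -> -> -> -> -> -> ->.
Qed.

(** The wedge in coordinates, expanded once so that the identities below become polynomial
    identities for [ring]. *)
Lemma oct_im_mul (x1 x2 x3 x4 x5 x6 x7 y1 y2 y3 y4 y5 y6 y7 : R) :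
  oct_im (oct_mul ((((0, x1), (x2, x3)), ((x4, x5), (x6, x7))) : octonion R)
                  (((0, y1), (y2, y3)), ((y4, y5), (y6, y7)))) =
    (((0, x2 * y3 + x4 * y5 + x7 * y6 - x3 * y2 - x5 * y4 - x6 * y7),
       (x3 * y1 + x4 * y6 + x5 * y7 - x1 * y3 - x6 * y4 - x7 * y5,
        x1 * y2 + x6 * y5 + x4 * y7 - x2 * y1 - x7 * y4 - x5 * y6)),
      ((x5 * y1 + x6 * y2 + x7 * y3 - x1 * y5 - x2 * y6 - x3 * y7,
        x1 * y4 + x3 * y6 + x7 * y2 - x2 * y7 - x4 * y1 - x6 * y3),
       (x2 * y4 + x1 * y7 + x5 * y3 - x3 * y5 - x4 * y2 - x7 * y1,
        x2 * y5 + x3 * y4 + x6 * y1 - x1 * y6 - x5 * y2 - x4 * y3)))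
    :> octonion R.
Proof.
rewrite /oct_im /oct_re /oct_mul /quat_mul /cplx_mul /quat_conj /cplx_conj /=.
rewrite /cd_mul /cd_conj /oct_one /=.
congr (((_, _), (_, _)), ((_, _), (_, _))); rewrite /= /GRing.scale /=; ring.
Qed.

Lemma wedge_anti x y : x ^^ y = - (y ^^ x).
Proof.
apply/subvs_inj; rewrite vsvalN.
have := val_wedge x y; have := val_wedge y x.
generalize (vsval (x ^^ y)) (vsval (y ^^ x)) => u v -> ->.
have := W_re x; have := W_re y.
case: (vsval x) => [[[x0 x1] [x2 x3]] [[x4 x5] [x6 x7]]].
case: (vsval y) => [[[y0 y1] [y2 y3]] [[y4 y5] [y6 y7]]] /= -> ->.
rewrite !oct_im_mul.
congr (((_, _), (_, _)), ((_, _), (_, _))); rewrite /= /GRing.scale /=; ring.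
Qed.

Lemma oform_wedge x y z : o (x ^^ y) z = o x (y ^^ z).
Proof.
rewrite !oformE; have := val_wedge x y; have := val_wedge y z.
generalize (vsval (x ^^ y)) (vsval (y ^^ z)) => u v.
have := W_re x; have := W_re y; have := W_re z.
case: (vsval x) => [[[x0 x1] [x2 x3]] [[x4 x5] [x6 x7]]].
case: (vsval y) => [[[y0 y1] [y2 y3]] [[y4 y5] [y6 y7]]].
case: (vsval z) => [[[z0 z1] [z2 z3]] [[z4 z5] [z6 z7]]] /= -> -> ->.
rewrite !oct_im_mul => -> -> /=.
ring.
Qed.

Lemma wedge_wedge x y : x ^^ (x ^^ y) = o x x *: y - o x y *: x.
Proof.
rewrite !oformE; apply/subvs_inj; rewrite vsvalD vsvalN !vsvalZ.
have := val_wedge x (x ^^ y); have := val_wedge x y.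
generalize (vsval (x ^^ (x ^^ y))) (vsval (x ^^ y)) => u v -> ->.
have := W_re x; have := W_re y.
case: (vsval x) => [[[x0 x1] [x2 x3]] [[x4 x5] [x6 x7]]].
case: (vsval y) => [[[y0 y1] [y2 y3]] [[y4 y5] [y6 y7]]] /= -> ->.
rewrite !oct_im_mul.
congr (((_, _), (_, _)), ((_, _), (_, _))); rewrite /= /GRing.scale /=; ring.
Qed.

End OctonionCrossProduct.

Lemma octonion_cross_product (R : realType) :
  cross_product (@oform R) (@wedge R).
Proof.
split.
- exact: oformC.
- exact: oformDr.
- exact: oformZr.
- exact: oform_le0.
- exact: oform_eq0.
- exact: wedge_anti.
- exact: oform_wedge.
- exact: wedge_wedge.
- exact: oform_adjointP.
Qed.

(** By rank-nullity: the scalar part has rank at most 1 on a space of dimension 8. *)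
Lemma dim_W (R : realType) : (3 < dim (W R))%N.
Proof.
have := limg_ker_dim (linfun (@oct_re R)) fullv.
rewrite capfv dimvf => h.
have h1 := dimvS (subvf (limg (linfun (@oct_re R)))).
rewrite dimvf in h1.
suff : (3 < \dim (imO R))%N by [].
have : (\dim (imO R) + \dim (limg (linfun (@oct_re R))) = 8)%N by exact: h.
have : (\dim (limg (linfun (@oct_re R))) <= 1)%N by exact: h1.
by case: (\dim (limg _)) => [|[|//]] _;
  [rewrite addn0 => -> | rewrite addn1 => -[->]].
Qed.

Lemma O7P (R : realType) (f : 'End(W R)) :
  O7 f <-> forall x y, oform (f x) (f y) = oform x y.
Proof.
by split=> h x y; [apply: oppr_inj; exact: h | congr (- _); exact: h].
Qed.

Theorem mainTheorem8 (R : realType) (phi psi : 'End(W R))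
    (phi_bij : bijective phi) (psi_bij : bijective psi) :
  [/\ alg_isomorphic (isotope phi) (@OO_mul R) <-> O7 phi,
      (forall u v, isotope phi u v = isotope psi u v) <->
        G2 (valg_ext (phi \o psi^-1)%VF)
    & alg_isomorphic (isotope phi) (isotope psi) <->
        exists f : 'End(W R),
          O7 f /\ G2 (valg_ext ((phi \o f) \o psi^-1)%VF)].
Proof.
have cp := octonion_cross_product R; have dimW := dim_W R; split.
- rewrite O7P; exact: isotope_iso_isometryP.
- have kB : bijective (phi \o psi^-1)%VF.
    apply: lfun_inj_bij => x y; rewrite !comp_lfunE => /(bij_inj phi_bij).
    exact: (can_inj (lfun_bijVK psi_bij)).
  apply: (iff_trans (isotope_mul_eqP cp phi psi_bij)).
  by apply: iff_sym; exact: valg_ext_autP.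
- apply: iff_trans (isotope_iso_ext_autP cp dimW phi_bij psi_bij) _.
  by split=> -[f [fo fG]]; exists f; split=> //; apply/O7P.
Qed.
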